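(* In the quantum number-in-hand network model, there is a quantum protocol with communication cost $O(k\log^2 k)$ which, with probability at least $2/3$, outputs the neighborhood diversity of the input $k$-node graph.
   Context: Quantum number-in-hand (NIH) network model: the input is an undirected graph $G=(V,E)$ without self-loops on $V=[k]$; player $v\in[k]$ receives only $\nu_v\in\{0,1\}^k$, the characteristic vector of its neighborhood $N(v)$; each player sends one quantum message depending only on its own input (no shared randomness or entanglement) to a referee, who outputs the answer; cost is the total number of qubits sent. Nodes $u\ne v$ are false twins if non-adjacent with $N(u)=N(v)$, true twins if adjacent with $N(u)\cup\{u\}=N(v)\cup\{v\}$, and twins if either. The neighborhood diversity of $G$ is the minimum $d$ such that $V$ can be partitioned into $d$ sets in each of which every two distinct nodes are twins. *)

(* Defs.v *)
From Stdlib Require Rdefinitions.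
From HB Require Import structures.
From mathcomp Require Import all_boot all_order all_algebra.
From mathcomp Require Import Rstruct complex.
Set Implicit Arguments. Unset Strict Implicit. Unset Printing Implicit Defensive.
Import Order.TTheory GRing.Theory Num.Theory.
Local Open Scope ring_scope.

Definition Cplx : numClosedFieldType := (Rdefinitions.R)[i].

Definition op (T : finType) := T -> T -> Cplx.

Definition psd (T : finType) (A : op T) : Prop :=
  (forall i j, A j i = Num.conj (A i j)) /\
  (forall x : T -> Cplx,
      0 <= \sum_(i : T) \sum_(j : T) Num.conj (x i) * A i j * x j).

Definition density (T : finType) (rho : op T) : Prop :=
  psd rho /\ \sum_(i : T) rho i i = 1.

Definition trace_mul (T : finType) (A B : op T) : Cplx :=
  \sum_(i : T) \sum_(j : T) A i j * B j i.

Definition simple_graph (k : nat) (adj : rel 'I_k) : Prop :=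
  symmetric adj /\ irreflexive adj.

(* N(v) ; its characteristic vector nu_v is the input of player v *)
Definition nbhd (k : nat) (adj : rel 'I_k) (v : 'I_k) : {set 'I_k} :=
  [set u | adj v u].

Definition false_twins k (adj : rel 'I_k) (u v : 'I_k) : bool :=
  [&& u != v, ~~ adj u v & nbhd adj u == nbhd adj v].
Definition true_twins k (adj : rel 'I_k) (u v : 'I_k) : bool :=
  [&& u != v, adj u v & u |: nbhd adj u == v |: nbhd adj v].
Definition twins k (adj : rel 'I_k) (u v : 'I_k) : bool :=
  false_twins adj u v || true_twins adj u v.

(* V can be partitioned into (at most) d classes in each of which any two
   distinct nodes are twins; a class is the fibre of a labelling f. *)
Definition twin_partition k (adj : rel 'I_k) (d : nat) : bool :=
  [exists f : {ffun 'I_k -> 'I_d},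
     [forall u, forall v, (u != v) && (f u == f v) ==> twins adj u v]].

Lemma twin_partition_exists k (adj : rel 'I_k) : exists d, twin_partition adj d.
Proof.
exists k; apply/existsP; exists [ffun u => u].
by apply/forallP => u; apply/forallP => v; rewrite !ffunE; case: eqP.
Qed.

Definition neighborhood_diversity k (adj : rel 'I_k) : nat :=
  ex_minn (twin_partition_exists adj).

(* joint Hilbert-space basis index of all messages (tensor product) *)
Definition joint_index (k : nat) (m : 'I_k -> nat) : finType :=
  {dffun forall v : 'I_k, 'I_(2 ^ m v)}.

Record qnih_protocol (k : nat) := QNIH {
  qubits : 'I_k -> nat;
  message : forall v : 'I_k, {set 'I_k} -> op 'I_(2 ^ qubits v);
  n_outcomes : nat;
  povm : 'I_n_outcomes -> op (joint_index qubits);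
  label : 'I_n_outcomes -> nat
}.
Arguments qubits {k} P v : rename.
Arguments message {k} P v nu _ _ : rename.
Arguments n_outcomes {k} P : rename.
Arguments povm {k} P o _ _ : rename.
Arguments label {k} P o : rename.

Definition valid_protocol k (P : qnih_protocol k) : Prop :=
  (forall v (nu : {set 'I_k}), density (message P v nu)) /\
  (forall o, psd (povm P o)) /\
  (forall i j, \sum_(o : 'I_(n_outcomes P)) povm P o i j = (i == j)%:R).

Definition cost k (P : qnih_protocol k) : nat := \sum_(v < k) qubits P v.

(* joint state: tensor product of the messages, entrywise *)
Definition joint_state k (P : qnih_protocol k) (nu : 'I_k -> {set 'I_k})
  : op (joint_index (qubits P)) :=
  fun i j => \prod_(v < k) message P v (nu v) (i v) (j v).
Arguments joint_state {k} P nu _ _ : rename.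

Definition prob_output k (P : qnih_protocol k) (nu : 'I_k -> {set 'I_k}) (d : nat)
  : Cplx :=
  \sum_(o : 'I_(n_outcomes P) | label P o == d) trace_mul (povm P o) (joint_state P nu).

(* Main.v *)
(* Player v sends t copies of a Reed-Solomon fingerprint of N(v) and t copies of
   one of N(v) + v, over a field with at least 4k elements, so that fingerprints
   of distinct sets have overlap at most 1/4.  Two distinct nodes are twins iff
   one of these two inputs agrees for them.  For each pair of nodes and each of
   the two kinds of input, the referee projects onto the states invariant under
   swapping any subset of the t pairs of copies: equal inputs always pass, and
   unequal ones pass with probability at most (5/8)^t.  Each test therefore
   barely disturbs the state when its outcome is the right one, so performing
   the n = 2k^2 tests one after the other on the same state moves it by at most
   n (5/8)^(t/2) in norm, and t = O(log k) copies suffice for all the outcomes to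
   be right with probability at least 2/3. *)
Require Import Defs.
From HB Require Import structures.
From mathcomp Require Import all_boot all_order all_algebra.
From mathcomp Require Import perm finfield.
From mathcomp Require Import ring zify.
Set Implicit Arguments. Unset Strict Implicit. Unset Printing Implicit Defensive.
Import Order.TTheory GRing.Theory Num.Theory.
Local Open Scope ring_scope.

(** * Complex conjugation *)

Section Conjugation.
Variable C : numClosedFieldType.
Implicit Types x y : C.
Lemma conjM x y : (x * y)^* = x^* * y^*. Proof. exact: rmorphM. Qed.
Lemma conjD x y : (x + y)^* = x^* + y^*. Proof. exact: rmorphD. Qed.
Lemma conjB x y : (x - y)^* = x^* - y^*. Proof. exact: rmorphB. Qed.
Lemma conj_invn n : (n%:R^-1)^* = n%:R^-1 :> C.
Proof. by rewrite geC0_conj // invr_ge0 ler0n. Qed.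
End Conjugation.

(** * Finite-dimensional complex inner product spaces *)

Section Vectors.
Variables (C : numClosedFieldType) (T : finType).
Local Notation V := {ffun T -> C^o}.
Implicit Types f g : V.

Definition dot f g : C := \sum_i f i * (g i)^*.
Definition basis_vec (i : T) : V := [ffun j => (j == i)%:R].

Lemma dotBl f1 f2 g : dot (f1 - f2) g = dot f1 g - dot f2 g.
Proof. by rewrite /dot -sumrB; apply: eq_bigr => i _; rewrite !ffunE mulrBl. Qed.

Lemma dotBr f g1 g2 : dot f (g1 - g2) = dot f g1 - dot f g2.
Proof. by rewrite /dot -sumrB; apply: eq_bigr => i _; rewrite !ffunE conjB mulrBr. Qed.

Lemma dot_ge0 f : 0 <= dot f f.
Proof. by apply: sumr_ge0 => i _; rewrite mul_conjC_ge0. Qed.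

Lemma dot_conj f g : (dot f g)^* = dot g f.
Proof.
rewrite /dot (rmorph_sum (@Num.conj C)); apply: eq_bigr => i _.
by rewrite /= conjM conjCK mulrC.
Qed.

Lemma dot_basis i j : dot (basis_vec j) (basis_vec i) = (i == j)%:R.
Proof.
rewrite /dot (bigD1 j) //= big1 => [|l /negPf lj]; last by rewrite !ffunE lj mul0r.
by rewrite !ffunE eqxx mul1r addr0 conjC_nat eq_sym.
Qed.

Lemma vec_sum f : f = \sum_i f i *: basis_vec i.
Proof.
apply/ffunP => j; rewrite sum_ffunE (bigD1 j) //= big1 => [|l lj].
  by rewrite !ffunE eqxx addr0 /GRing.scale /= mulr1.
by rewrite !ffunE eq_sym (negPf lj) /GRing.scale /= mulr0.
Qed.

Lemma vec_eta f : [ffun i => f i] = f.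
Proof. by apply/ffunP => i; rewrite ffunE. Qed.

(** The inner products on the left are the entries of K^* K, whose quadratic form is the squared
    norm of K x. This gives both positivity of the effects and the Born rule. *)
Lemma dot_linear (K : {linear V -> V}) (x : T -> C) :
  \sum_i \sum_j (x i)^* * dot (K (basis_vec j)) (K (basis_vec i)) * x j =
  dot (K [ffun i => x i]) (K [ffun i => x i]).
Proof.
have Kx l : K [ffun i => x i] l = \sum_i x i * K (basis_vec i) l.
  rewrite {1}[finfun _]vec_sum linear_sum sum_ffunE; apply: eq_bigr => i _.
  by rewrite linearZ !ffunE.
rewrite {2}/dot; under [RHS]eq_bigr => l _ do rewrite Kx rmorph_sum mulr_sumr.
rewrite [RHS]exchange_big; apply: eq_bigr => i _ /=.
under [RHS]eq_bigr => l _ do rewrite mulr_suml.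
rewrite [RHS]exchange_big; apply: eq_bigr => j _ /=.
rewrite /dot mulr_sumr mulr_suml; apply: eq_bigr => l _.
by rewrite conjM; ring.
Qed.

(** The difference of the two sides is the squared norm of m f - g. This replaces the triangle
    inequality and keeps square roots out of the error analysis. *)
Lemma dot_add_weighted (m : nat) f g :
  m%:R * dot (f + g) (f + g) <=
  (m * m.+1)%:R * dot f f + m.+1%:R * dot g g.
Proof.
rewrite /dot !mulr_sumr -big_split; apply: ler_sum => i _ /=; rewrite !ffunE.
set a : C := f i; set b : C := g i; rewrite -subr_ge0.
have -> : (m * m.+1)%:R * (a * a^*) + m.+1%:R * (b * b^*) -
    m%:R * ((a + b) * (a + b)^*) = (m%:R * a - b) * (m%:R * a - b)^*.
  rewrite conjB conjD conjM conjC_nat natrM -[m.+1%:R]natr1.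
  ring.
exact: mul_conjC_ge0.
Qed.

(** * Sequences of two-outcome projective measurements *)

Section Sequential.
Variables (D : finType) (P : D -> {linear V -> V}).
Hypothesis P_adj : forall d f g, dot (P d f) g = dot f (P d g).
Hypothesis P_idem : forall d f, P d (P d f) = P d f.

Definition branch d (b : bool) : V -> V :=
  fun f => if b then P d f else f - P d f.

(* The last test of the list is performed first. *)
Fixpoint collapse (ds : seq D) (s : seq bool) : V -> V :=
  match ds, s with
  | d :: ds', b :: s' => fun f => branch d b (collapse ds' s' f)
  | _, _ => fun f => f
  end.

Lemma collapse_is_linear ds s : linear (collapse ds s).
Proof.
elim: ds s => [|d ds IH] [|b s] //= c f g; rewrite IH /branch.
case: b; rewrite linearP //.
by rewrite scalerBr opprD addrACA.
Qed.
HB.instance Definition _ ds s :=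
  GRing.isLinear.Build C V V _ (collapse ds s) (collapse_is_linear ds s).

Fixpoint bits (n : nat) : seq (seq bool) :=
  if n is n'.+1 then [seq b :: s | b <- [:: true; false], s <- bits n']
  else [:: [::]].

Lemma mem_bits s : s \in bits (size s).
Proof.
elim: s => //= b s IH; rewrite cats0 mem_cat.
by case: b; rewrite map_f ?orbT.
Qed.

Lemma dot_branch d f g :
  dot (branch d true f) (branch d true g) +
  dot (branch d false f) (branch d false g) = dot f g.
Proof.
rewrite /= !dotBl !dotBr !P_adj !P_idem; ring.
Qed.

Lemma branch_contract d b f : dot (branch d b f) (branch d b f) <= dot f f.
Proof.
rewrite -(dot_branch d f f); case: b; first by rewrite lerDl dot_ge0.
by rewrite lerDr dot_ge0.
Qed.

Lemma branchB d b f g : branch d b (f - g) = branch d b f - branch d b g.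
Proof. by case: b; rewrite /= linearB //= !opprD !opprK addrACA. Qed.

(** Completeness of the measurement: over all outcome strings, the operators K^* K sum to the
    identity. *)
Lemma sum_collapse ds f g :
  \sum_(s <- bits (size ds)) dot (collapse ds s f) (collapse ds s g) = dot f g.
Proof.
elim: ds => [|d ds IH] /=; first by rewrite big_seq1.
rewrite -IH big_cat /= cats0 !big_map -big_split /=.
by apply: eq_bigr => s _; rewrite dot_branch.
Qed.

(** Each right outcome moves [psi] by at most sqrt eps in norm, and a projection does not enlarge
    the deviation left by earlier tests, so the errors add up. *)
Lemma collapse_gentle (e : D -> bool) (psi : V) (eps : C) ds :
  (forall d, dot (psi - branch d (e d) psi) (psi - branch d (e d) psi) <= eps) ->
  dot (psi - collapse ds (map e ds) psi) (psi - collapse ds (map e ds) psi)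
    <= (size ds ^ 2)%:R * eps.
Proof.
move=> Heps; elim: ds => [|d ds IH] /=.
  by rewrite subrr mul0r /dot big1 // => i _; rewrite ffunE mul0r.
set chi := collapse _ _ _ in IH *; set n := size ds in IH *.
set a := psi - branch d (e d) psi.
set b := branch d (e d) (psi - chi).
have -> : psi - branch d (e d) chi = a + b.
  by rewrite /a /b branchB addrA subrK.
have Hb : dot b b <= (n ^ 2)%:R * eps by apply: le_trans IH; apply: branch_contract.
have := dot_add_weighted n a b.
(* At n = 0 the weighted inequality gives no bound, so the vanishing of [b] is derived directly. *)
case: n Hb {IH} => [|n] Hb H.
  have b0 : dot b b = 0 by apply/eqP; rewrite eq_le dot_ge0 andbT (le_trans Hb) // mul0r.
  have {}b0 : b = 0.
    apply/ffunP => i; rewrite ffunE; apply/eqP; rewrite -mul_conjC_eq0.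
    move/eqP: b0; rewrite psumr_eq0 => [/allP/(_ i)|j _]; last exact: mul_conjC_ge0.
    by rewrite mem_index_enum => /(_ isT).
  by rewrite b0 addr0 mul1r; apply: Heps.
rewrite -(ler_pM2l (x := n.+1%:R)) ?ltr0Sn //; apply: le_trans H _.
apply: (@le_trans _ _ ((n.+1 * n.+2)%:R * eps + n.+2%:R * ((n.+1 ^ 2)%:R * eps))).
  by apply: lerD; apply: ler_wpM2l => //; apply: Heps.
rewrite !mulrA -!natrM -mulrDl -natrD.
suff -> : (n.+1 * n.+2 + n.+2 * n.+1 ^ 2 = n.+1 * n.+2 ^ 2)%N by [].
by nia.
Qed.

Lemma collapse_success (e : D -> bool) (psi : V) (eps : C) ds :
  dot psi psi = 1 ->
  (forall d, dot (psi - branch d (e d) psi) (psi - branch d (e d) psi) <= eps) ->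
  (30 * size ds ^ 2)%:R * eps <= 1 ->
  2 / 3 <= dot (collapse ds (map e ds) psi) (collapse ds (map e ds) psi).
Proof.
move=> psi1 Heps Hsmall; have := collapse_gentle ds Heps.
set chi := collapse _ _ _ => H.
(* The weight 5 gives 5 <= 30 |psi - chi|^2 + 6 |chi|^2; the first term is at most 1, leaving
   |chi|^2 >= 4/6. *)
have := dot_add_weighted 5 (psi - chi) chi; rewrite subrK psi1 mulr1 => H5.
have Hd : 30%:R * dot (psi - chi) (psi - chi) <= 1.
  apply: le_trans Hsmall; rewrite natrM -mulrA.
  by apply: ler_wpM2l.
have : 4%:R <= 6%:R * dot chi chi.
  have := le_trans H5 (lerD Hd (lexx _)).
  by rewrite -lerBlDl -[X in _ - X]/(1%:R) -natrB.
have -> : 4%:R = 2%:R * 2%:R :> C by rewrite -natrM.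
have -> : 6%:R * dot chi chi = 2%:R * (dot chi chi * 3%:R) by ring.
by rewrite ler_pM2l ?ltr0Sn // ler_pdivrMr ?ltr0Sn.
Qed.

End Sequential.

(** * Projection onto invariant vectors by averaging *)

Section Average.
Variables (G : finType) (mul : G -> G -> G) (act : G -> T -> T).
Hypothesis act_inv : forall h, involutive (act h).
Hypothesis mul_inj : forall h, injective (mul h).
Hypothesis act_mul : forall h1 h2 i, act h1 (act h2 i) = act (mul h2 h1) i.
Hypothesis G_gt0 : (0 < #|G|)%N.

Definition average f : V := [ffun i => #|G|%:R^-1 * \sum_h f (act h i)].

Lemma average_is_linear : linear average.
Proof.
move=> c f g; apply/ffunP => i; rewrite !ffunE /GRing.scale /=.
under eq_bigr => x _ do rewrite !ffunE.
by rewrite big_split -mulr_sumr mulrDr mulrCA.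
Qed.
HB.instance Definition _ :=
  GRing.isLinear.Build C V V _ average average_is_linear.

Lemma average_adj f g : dot (average f) g = dot f (average g).
Proof.
rewrite /dot.
under eq_bigr => i _ do rewrite ffunE -mulrA mulr_suml.
under [RHS]eq_bigr => i _ do rewrite ffunE conjM rmorph_sum conj_invn mulrCA mulr_sumr.
rewrite -!mulr_sumr; congr (_ * _); rewrite exchange_big [RHS]exchange_big.
apply: eq_bigr => x _ /=; rewrite (reindex_inj (inv_inj (act_inv x))).
by apply: eq_bigr => i _; rewrite act_inv.
Qed.

Lemma average_fix f : (forall h i, f (act h i) = f i) -> average f = f.
Proof.
move=> Hf; apply/ffunP => i; rewrite ffunE; under eq_bigr => x _ do rewrite Hf.
by rewrite sumr_const -[X in _ * X]mulr_natl mulrA mulVf ?mul1r // pnatr_eq0 -lt0n.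
Qed.

(** Acting by [h] only permutes the terms of the sum, [mul h] being injective on a finite type; so
    an average is invariant, hence fixed by averaging. *)
Lemma average_idem f : average (average f) = average f.
Proof.
apply: average_fix => h i; rewrite !ffunE; congr (_ * _).
rewrite [RHS](reindex_inj (@mul_inj h)) /=.
by apply: eq_bigr => g _; rewrite act_mul.
Qed.

End Average.
End Vectors.

(** * Reed-Solomon fingerprints *)

Section ReedSolomon.
Variables (C : numClosedFieldType) (F : finFieldType) (k : nat).
Implicit Types x y : {set 'I_k}.

Definition set_poly x : {poly F} :=
  \poly_(i < k) (i \in [seq val j | j <- enum x])%:R.

Lemma set_poly_inj : injective set_poly.
Proof.
move=> x y exy; apply/setP => i.
have := congr1 (fun p : {poly F} => p`_i) exy; rewrite /set_poly !coef_poly ltn_ord.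
rewrite !(mem_map val_inj) !mem_enum.
by case: (i \in x) (i \in y) => [] [] //= /eqP; rewrite ?oner_eq0 // eq_sym oner_eq0.
Qed.

(** Points of agreement are roots of a nonzero polynomial of degree below k. *)
Lemma card_agree x y :
  x != y -> (#|[pred a | (set_poly x).[a] == (set_poly y).[a]]| <= k)%N.
Proof.
move=> nxy; set p := set_poly x - set_poly y.
have p0 : p != 0 by rewrite subr_eq0 (inj_eq set_poly_inj).
rewrite cardE; set rs := enum _.
have Hr : all (root p) rs.
  apply/allP => a; rewrite mem_enum inE => /eqP e.
  by rewrite /root hornerD hornerN e subrr.
have := max_poly_roots p0 Hr (enum_uniq _) => /ltnW /leq_trans; apply.
rewrite (leq_trans (size_polyD _ _)) // size_polyN geq_max.
by rewrite !size_poly.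
Qed.

(** Amplitudes of the uniform superposition of the states |a>|p(a)>, with p the polynomial of [x].
    They are real, so overlaps are written without conjugates. *)
Definition fingerprint x (b : F * F) : C :=
  ((set_poly x).[b.1] == b.2)%:R / sqrtC #|F|%:R.

Lemma fingerprint_ge0 x b : 0 <= fingerprint x b.
Proof. by rewrite divr_ge0 // sqrtC_ge0 ler0n. Qed.

Lemma fingerprint_overlap x y :
  \sum_b fingerprint x b * fingerprint y b =
  #|[pred a | (set_poly x).[a] == (set_poly y).[a]]|%:R / #|F|%:R.
Proof.
rewrite -(pair_bigA _ (fun a c => fingerprint x (a, c) * fingerprint y (a, c))) /=.
rewrite -sum1_card natr_sum mulr_suml [RHS]big_mkcond; apply: eq_bigr => a _ /=.
rewrite (bigD1 (set_poly x).[a]) //= big1 => [|c nc].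
  rewrite addr0 /fingerprint /= eqxx inE [_ == (set_poly x).[a]]eq_sym.
  by rewrite mulrACA -invfM -expr2 sqrtCK; case: eqP; rewrite !(mul1r, mul0r).
by rewrite /fingerprint /= eq_sym (negPf nc) !mul0r.
Qed.

Lemma fingerprint_norm x : \sum_b fingerprint x b * fingerprint x b = 1.
Proof.
rewrite fingerprint_overlap (eq_card (B := predT)) => [|a]; last by rewrite !inE eqxx.
by rewrite divff // pnatr_eq0 -lt0n; apply/card_gt0P; exists 0.
Qed.

Lemma fingerprint_near_orthogonal x y : (4 * k <= #|F|)%N -> x != y ->
  \sum_b fingerprint x b * fingerprint y b <= 4%:R^-1.
Proof.
move=> kF nxy; rewrite fingerprint_overlap.
have F0 : (0 < #|F|)%N by apply/card_gt0P; exists 0.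
rewrite ler_pdivrMr ?ltr0n // ler_pdivlMl ?ltr0Sn // -natrM ler_nat.
by apply: leq_trans kF; rewrite leq_mul2l card_agree.
Qed.

End ReedSolomon.

Lemma prod_le1 (C : numClosedFieldType) (I : finType) (P : pred I) (f : I -> C) :
  (forall i, 0 <= f i <= 1) -> 0 <= \prod_(i | P i) f i <= 1.
Proof.
move=> H; rewrite prodr_ge0 => [/=|i _]; last by case/andP: (H i).
by rewrite prodr_ile1 // => i; case/andP: (H i) => -> ->.
Qed.

(** * Swap tests on t copies *)

Section SwapTests.
Variables (C : numClosedFieldType) (X : eqType) (B : finType) (phi : X -> B -> C).
Hypothesis phi_ge0 : forall x b, 0 <= phi x b.
Hypothesis phi_norm : forall x, \sum_b phi x b * phi x b = 1.
Hypothesis phi_sep : forall x y, x != y -> \sum_b phi x b * phi y b <= 4%:R^-1.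

Lemma overlap_bounds x y : 0 <= \sum_b phi x b * phi y b <= 1.
Proof.
rewrite sumr_ge0 /= => [|b _]; last by rewrite mulr_ge0.
case: (eqVneq x y) => [->|/phi_sep/le_trans]; first by rewrite phi_norm.
by apply; rewrite invf_le1 ?ltr0Sn // ler1n.
Qed.

Variables (k t : nat).
(* The register (v, (c, j)) holds the j-th copy of player v's fingerprint of
   N(v) (c = false) or of N(v) + v (c = true); the test (c, (u, v)) compares the
   inputs of kind c of u and v. *)
Definition register : finType := ('I_k * (bool * 'I_t))%type.
Definition test : finType := (bool * ('I_k * 'I_k))%type.
Local Notation T := {ffun register -> B}.
Implicit Types (d : test) (S : {ffun 'I_t -> bool}) (g : T).

Definition swap_register d S (a : register) : register :=
  if (a.2.1 == d.1) && S a.2.2 then (tperm d.2.1 d.2.2 a.1, a.2) else a.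

Definition swap_copies d S g : T := [ffun a => g (swap_register d S a)].

(** For a fixed test, swaps of distinct copies commute and square to the identity, so subsets of
    copies act as the group (Z/2)^t. *)
Definition copies_xor S S' : {ffun 'I_t -> bool} := [ffun j => S j (+) S' j].

Lemma swap_register_inv d S : involutive (swap_register d S).
Proof.
move=> [v [c j]]; rewrite /swap_register /=.
by case E: ((c == d.1) && S j); rewrite /= E ?tpermK.
Qed.

Lemma swap_copies_inv d S : involutive (swap_copies d S).
Proof. by move=> g; apply/ffunP => a; rewrite !ffunE swap_register_inv. Qed.

Lemma copies_xor_inj S : injective (copies_xor S).
Proof.
by move=> S1 S2 /ffunP e; apply/ffunP => j; move: (e j); rewrite !ffunE => /addbI.
Qed.

Lemma swap_copies_mul d S1 S2 g :
  swap_copies d S1 (swap_copies d S2 g) = swap_copies d (copies_xor S2 S1) g.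
Proof.
apply/ffunP => -[v [c j]]; rewrite !ffunE /swap_register /= !ffunE.
case E: (c == d.1) => /=; last by rewrite E.
by case: (S1 j) => /=; rewrite E /=; case: (S2 j); rewrite //= tpermK.
Qed.

Lemma copies_gt0 : (0 < #|{: {ffun 'I_t -> bool}}|)%N.
Proof. by apply/card_gt0P; exists [ffun=> false]. Qed.

(** The average over subsets is the product over copies of (1 + swap)/2: the test passes when all t
    ordinary swap tests pass. *)
Definition swap_test d : {linear {ffun T -> C^o} -> {ffun T -> C^o}} :=
  average (C := C) (swap_copies d).

Lemma swap_test_adj d f1 f2 : dot (swap_test d f1) f2 = dot f1 (swap_test d f2).
Proof. by apply: average_adj => S; apply: swap_copies_inv. Qed.

Lemma swap_test_idem d f : swap_test d (swap_test d f) = swap_test d f.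
Proof.
apply: (average_idem (mul := copies_xor)); first exact: copies_xor_inj.
  exact: swap_copies_mul.
exact: copies_gt0.
Qed.

Variable inp : 'I_k -> bool -> X.

Definition product_state : {ffun T -> C^o} :=
  [ffun g : T => \prod_a phi (inp a.1 a.2.1) (g a)].

Definition equal_inputs d : bool := inp d.2.1 d.1 == inp d.2.2 d.1.

Lemma product_state_conj g : (product_state g : C)^* = product_state g.
Proof. by rewrite geC0_conj // ffunE prodr_ge0. Qed.

Lemma product_state_swap d S g : product_state (swap_copies d S g) =
  \prod_a phi (inp (swap_register d S a).1 (swap_register d S a).2.1) (g a).
Proof.
rewrite ffunE (reindex_inj (inv_inj (swap_register_inv d S))).
by apply: eq_bigr => a _; rewrite ffunE swap_register_inv.
Qed.

Lemma product_state_overlap d S :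
  \sum_g product_state (swap_copies d S g) * (product_state g : C)^* =
  \prod_a \sum_b phi (inp (swap_register d S a).1 (swap_register d S a).2.1) b *
     phi (inp a.1 a.2.1) b.
Proof.
rewrite bigA_distr_bigA; apply: eq_bigr => g _.
by rewrite product_state_conj product_state_swap ffunE -big_split.
Qed.

Lemma product_state_norm : dot product_state product_state = 1.
Proof.
transitivity (\prod_(a : register)
  \sum_b phi (inp a.1 a.2.1) b * phi (inp a.1 a.2.1) b); last by rewrite big1.
rewrite bigA_distr_bigA; apply: eq_bigr => g _.
by rewrite product_state_conj ffunE -big_split.
Qed.

Lemma swap_test_equal d :
  equal_inputs d -> swap_test d product_state = product_state.
Proof.
move=> /eqP e; apply: average_fix => [|S g]; first exact: copies_gt0.
rewrite product_state_swap ffunE; apply: eq_bigr => -[v [c j]] _.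
rewrite /swap_register /=; case: ifP => //= /andP[/eqP -> _]; congr (phi _ _).
by case: tpermP => [->|->|] //; rewrite ?e.
Qed.

(** In each swapped copy, the register of the first player meets the state of a different input, a
    factor at most 1/4. All other factors, those of the second player included, are bounded by 1. *)
Lemma swap_overlap_unequal d S : ~~ equal_inputs d ->
  \sum_g product_state (swap_copies d S g) * (product_state g : C)^* <=
  \prod_j (if S j then 4%:R^-1 else 1).
Proof.
move=> ne; rewrite product_state_overlap.
pose w (a : register) := \sum_b
  phi (inp (swap_register d S a).1 (swap_register d S a).2.1) b * phi (inp a.1 a.2.1) b.
rewrite (eq_bigr w) //.
have w01 a : 0 <= w a <= 1 by apply: overlap_bounds.
rewrite (bigID (fun a : register => (a.1 == d.2.1) && (a.2.1 == d.1))) /=.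
rewrite (reindex (fun j : 'I_t => (d.2.1, (d.1, j)))); last first.
  by exists (fun a => a.2.2) => [j|[v [c j]] /andP[/eqP /= -> /eqP ->]].
rewrite (eq_bigl xpredT) => [|j]; last by rewrite /= !eqxx.
have /andP[r0 r1] := prod_le1 (fun a : register => ~~ ((a.1 == d.2.1) && (a.2.1 == d.1))) w01.
have /andP[l0 l1] := prod_le1 xpredT (fun j => w01 (d.2.1, (d.1, j))).
apply: le_trans (ler_wpM2l l0 r1) _; rewrite mulr1.
apply: ler_prod => j _; case/andP: (w01 (d.2.1, (d.1, j))) => -> w1 /=.
case: ifP => // Sj; rewrite /w /swap_register /= eqxx Sj /= tpermL.
by apply: phi_sep; rewrite eq_sym.
Qed.

Lemma swap_test_unequal d : ~~ equal_inputs d ->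
  dot (swap_test d product_state) (swap_test d product_state) <= (5%:R / 8%:R) ^+ t.
Proof.
move=> ne; rewrite -swap_test_adj swap_test_idem /dot.
under eq_bigr => g _ do rewrite ffunE -mulrA mulr_suml.
rewrite -mulr_sumr exchange_big /=.
have n0 : (0 : C) < #|{: {ffun 'I_t -> bool}}|%:R by rewrite ltr0n copies_gt0.
rewrite ler_pdivrMl //.
apply: le_trans (ler_sum _ (fun S _ => swap_overlap_unequal S ne)) _.
(* The sum over subsets factors over copies into (1 + 1/4)^t; division by the number 2^t of subsets
   gives (5/8)^t. *)
rewrite -(bigA_distr_bigA (fun _ (s : bool) => if s then 4%:R^-1 else 1)) /=.
rewrite prodr_const card_ord card_ffun card_bool card_ord natrX -exprMn.
rewrite big_bool /= (_ : 4%:R^-1 + 1 = 2%:R * (5%:R / 8%:R)) //.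
by field.
Qed.

Lemma branch_error d :
  dot (product_state - branch swap_test d (equal_inputs d) product_state)
      (product_state - branch swap_test d (equal_inputs d) product_state)
   <= (5%:R / 8%:R) ^+ t.
Proof.
case: (boolP (equal_inputs d)) => [e|ne] /=.
  rewrite swap_test_equal // subrr /dot big1 => [|i _]; last by rewrite ffunE mul0r.
  by rewrite exprn_ge0 // divr_ge0 // ler0n.
by rewrite opprB addrC subrK; apply: swap_test_unequal.
Qed.

End SwapTests.

(** * Clique partitions and twins *)

Section CliquePartition.
Variable k : nat.
Implicit Type e : rel 'I_k.

(** The relation is arbitrary because the referee must also label outcome strings that come from no
    graph. *)
Definition clique_partition e (d : nat) : bool :=
  [exists f : {ffun 'I_k -> 'I_d},
     [forall u, forall v, (u != v) && (f u == f v) ==> e u v]].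

Lemma clique_partition_exists e : exists d, clique_partition e d.
Proof.
exists k; apply/existsP; exists [ffun u => u].
by apply/forallP => u; apply/forallP => v; rewrite !ffunE; case: eqP.
Qed.

Definition clique_cover_number e : nat := ex_minn (clique_partition_exists e).

Lemma clique_cover_twins e (adj : rel 'I_k) :
  (forall u v, u != v -> e u v = twins adj u v) ->
  clique_cover_number e = neighborhood_diversity adj.
Proof.
move=> H; apply: eq_ex_minn => d; apply: eq_existsb => f.
apply: eq_forallb => u; apply: eq_forallb => v.
by case: (eqVneq u v) => //= /H ->.
Qed.

Definition player_input (nu : 'I_k -> {set 'I_k}) (v : 'I_k) (c : bool) :=
  if c then v |: nu v else nu v.

(** Equal open neighborhoods force non-adjacency, since v is not in N(v); equal closed ones force
    adjacency, since u then lies in N(v) + v and differs from v. *)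
Lemma twinsE (adj : rel 'I_k) u v : simple_graph adj -> u != v ->
  twins adj u v = [exists c,
    player_input (nbhd adj) u c == player_input (nbhd adj) v c].
Proof.
move=> [sym irr] uv; rewrite /twins /false_twins /true_twins uv /=.
have -> : [exists c, player_input (nbhd adj) u c == player_input (nbhd adj) v c] =
    (nbhd adj u == nbhd adj v) || (u |: nbhd adj u == v |: nbhd adj v).
  apply/existsP/orP => [[[]]|[]]; [by right|by left|by exists false|by exists true].
congr (_ || _).
  case: eqP => [/setP/(_ v)|]; last by rewrite andbF.
  by rewrite !inE irr => ->.
case: eqP => [/setP/(_ u)|]; last by rewrite andbF.
by rewrite !inE eqxx (negPf uv) /= sym => <-.
Qed.

End CliquePartition.

(** * Positive semidefinite matrices *)

Lemma psd_pullback (T U : finType) (h : T -> U) (A : op U) :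
  bijective h -> psd A -> psd (fun i j => A (h i) (h j)).
Proof.
move=> bij_h [A_herm A_pos]; have [h' hK h'K] := bij_h.
split=> [i j|x]; first exact: A_herm.
have := A_pos (x \o h'); rewrite (reindex h) /=; last exact: onW_bij.
suff -> : \sum_(i : T) \sum_(j : U) Num.conj (x (h' (h i))) * A (h i) j * x (h' j) =
    \sum_i \sum_j Num.conj (x i) * A (h i) (h j) * x j by [].
apply: eq_bigr => i _; rewrite (reindex h) /=; last exact: onW_bij.
by apply: eq_bigr => j _; rewrite !hK.
Qed.

(** The quadratic form is |<x, psi>|^2; nonnegative amplitudes are real, so the pure state is
    written without a conjugate. *)
Lemma psd_pure (T : finType) (psi : T -> Cplx) :
  (forall i, 0 <= psi i) -> psd (fun i j => psi i * psi j).
Proof.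
move=> psi0; have psiR i : Num.conj (psi i) = psi i by rewrite geC0_conj.
split=> [i j|x]; first by rewrite conjM !psiR mulrC.
set z := \sum_i Num.conj (x i) * psi i.
suff -> : \sum_i \sum_j Num.conj (x i) * (psi i * psi j) * x j = z * Num.conj z.
  exact: mul_conjC_ge0.
rewrite /z (rmorph_sum (@Num.conj Cplx)) mulr_suml; apply: eq_bigr => i _; rewrite mulr_sumr.
by apply: eq_bigr => j _; rewrite /= conjM conjCK psiR !mulrA mulrAC.
Qed.

(** * The protocol, its validity and its correctness *)

Section Protocol.
Variables (k t M : nat) (F : finFieldType).
Variable read : 'I_(2 ^ M) -> {ffun bool * 'I_t -> F * F}.
Hypothesis read_bij : bijective read.
Hypothesis F_large : (4 * k <= #|F|)%N.

Local Notation fp := (@fingerprint Cplx F k).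
Local Notation T := {ffun register k t -> F * F}.
Local Notation qubitsM := (fun _ : 'I_k => M).

(** The constant family [fun=> nu] is harmless, as [player_input] reads only its entry at [v]. *)
Definition fingerprints v (nu : {set 'I_k}) (w : {ffun bool * 'I_t -> F * F}) : Cplx :=
  \prod_c fp (player_input (fun=> nu) v c.1) (w c).

Definition read_all (i : joint_index qubitsM) : T :=
  [ffun a => read (i a.1) a.2].

Lemma read_all_bij : bijective read_all.
Proof.
have [write readK writeK] := read_bij.
exists (fun g : T => [ffun v => write [ffun c => g (v, c)]] : joint_index qubitsM).
  move=> i; apply/ffunP => v; rewrite ffunE -[RHS]readK; congr write.
  by apply/ffunP => c; rewrite !ffunE.
by move=> g; apply/ffunP => -[v c]; rewrite !ffunE writeK ffunE.
Qed.

Definition tests : seq (test k) := enum (test k).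
Definition outcomes : seq (seq bool) := bits (size tests).
(* The entry (i, j) of K^* K, where K is the composite of projectors selected by
   the outcomes s. *)
Definition effect (s : seq bool) : op T := fun i j =>
  dot (collapse (@swap_test Cplx (F * F)%type k t) tests s (basis_vec _ j))
      (collapse (@swap_test Cplx (F * F)%type k t) tests s (basis_vec _ i)).

Definition accepted (s : seq bool) : rel 'I_k := fun u v =>
  [exists c : bool, nth false s (index (c, (u, v)) tests)].

(** The successive tests are fused into one measurement indexed by complete outcome strings. *)
Definition nd_protocol : qnih_protocol k := {|
  qubits := qubitsM;
  message := fun v nu i j =>
    fingerprints v nu (read i) * fingerprints v nu (read j);
  n_outcomes := size outcomes;
  povm := fun o i j => effect (nth [::] outcomes o) (read_all i) (read_all j);
  label := fun o => clique_cover_number (accepted (nth [::] outcomes o)) |}.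

Lemma sum_outcomes (P : pred (seq bool)) (f : seq bool -> Cplx) :
  \sum_(o < size outcomes | P (nth [::] outcomes o)) f (nth [::] outcomes o) =
  \sum_(s <- outcomes | P s) f s.
Proof. by rewrite (big_nth [::]) big_mkord. Qed.

Lemma fingerprints_ge0 v nu w : 0 <= fingerprints v nu w.
Proof. by apply: prodr_ge0 => c _; apply: fingerprint_ge0. Qed.

Lemma nd_protocol_valid : valid_protocol nd_protocol.
Proof.
split; [move=> v nu; split | split].
- apply: (psd_pure (psi := fun i => fingerprints v nu (read i))) => i.
  exact: fingerprints_ge0.
- transitivity (\sum_w fingerprints v nu w * fingerprints v nu w).
    by rewrite (reindex read) //; apply: onW_bij.
  transitivity (\prod_(c : bool * 'I_t) \sum_b
      fp (player_input (fun=> nu) v c.1) b * fp (player_input (fun=> nu) v c.1) b).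
    by rewrite bigA_distr_bigA; apply: eq_bigr => w _; rewrite /fingerprints -big_split.
  by rewrite big1 // => c _; apply: fingerprint_norm.
- move=> o; apply: (psd_pullback (A := effect _)); first exact: read_all_bij.
  split=> [i j|x]; first by rewrite dot_conj.
  rewrite dot_linear; exact: dot_ge0.
- move=> i j /=; rewrite (sum_outcomes predT (fun s => effect s _ _)).
  rewrite sum_collapse ?dot_basis ?(bij_eq read_all_bij) //.
    exact: swap_test_adj.
  exact: swap_test_idem.
Qed.

Lemma nd_protocol_cost : cost nd_protocol = (k * M)%N.
Proof. by rewrite /cost sum_nat_const card_ord. Qed.

Lemma nd_protocol_state nu i j : joint_state nd_protocol nu i j =
  product_state fp t (player_input nu) (read_all i) *
  product_state fp t (player_input nu) (read_all j).
Proof.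
have E h : product_state fp t (player_input nu) (read_all h) =
    \prod_v fingerprints v (nu v) (read (h v)).
  rewrite ffunE /fingerprints pair_bigA /=.
  by apply: eq_bigr => -[v c] _; rewrite ffunE.
by rewrite !E -big_split.
Qed.

Definition residual nu (s : seq bool) : {ffun T -> Cplx^o} :=
  collapse (@swap_test Cplx _ k t) tests s (product_state fp t (player_input nu)).

(** Born rule: the trace of K^* K against a pure state psi is the squared norm of K psi. *)
Lemma nd_protocol_trace nu s :
  trace_mul (fun i j => effect s (read_all i) (read_all j))
    (joint_state nd_protocol nu) = dot (residual nu s) (residual nu s).
Proof.
rewrite /residual; set psi := product_state _ _ _.
have sum_read (f : T -> Cplx) : \sum_i f (read_all i) = \sum_g f g.
  rewrite [RHS](reindex read_all) //; exact: onW_bij read_all_bij.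
rewrite -[in RHS](vec_eta psi) -dot_linear -sum_read; apply: eq_bigr => i _.
rewrite -[RHS]sum_read; apply: eq_bigr => j _.
rewrite nd_protocol_state product_state_conj; last exact: fingerprint_ge0.
rewrite [RHS]mulrAC [LHS]mulrC; congr (_ * _); apply: mulrC.
Qed.

Lemma nd_protocol_correct (adj : rel 'I_k) : simple_graph adj ->
  (30 * #|test k| ^ 2)%:R * (5%:R / 8%:R : Cplx) ^+ t <= 1 ->
  2 / 3 <= prob_output nd_protocol (nbhd adj) (neighborhood_diversity adj).
Proof.
move=> adj_simple small.
set inp := player_input (nbhd adj).
(* The string of right outcomes: its contribution alone reaches 2/3, and the others are
   nonnegative. *)
set s := [seq equal_inputs inp d | d <- tests].
have s_in : s \in outcomes by rewrite /outcomes -(size_map (equal_inputs inp)) mem_bits.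
have label_s : clique_cover_number (accepted s) = neighborhood_diversity adj.
  apply: clique_cover_twins => u v uv; rewrite twinsE //; apply: eq_existsb => c.
  by rewrite (nth_map (c, (u, v))) ?index_mem ?mem_enum // nth_index ?mem_enum.
have -> : prob_output nd_protocol (nbhd adj) (neighborhood_diversity adj) =
    \sum_(s <- outcomes | clique_cover_number (accepted s) == neighborhood_diversity adj)
       dot (residual (nbhd adj) s) (residual (nbhd adj) s).
  by rewrite -sum_outcomes; apply: eq_bigr => o _; apply: nd_protocol_trace.
rewrite (big_rem s) //= label_s eqxx.
apply: (@le_trans _ _ (dot (residual (nbhd adj) s) (residual (nbhd adj) s))); last first.
  by rewrite lerDl sumr_ge0 // => s' _; apply: dot_ge0.
apply: (collapse_success (@swap_test_adj Cplx _ k t) (@swap_test_idem Cplx _ k t)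
  (eps := (5%:R / 8%:R) ^+ t)).
- by apply: product_state_norm; [apply: fingerprint_ge0|apply: fingerprint_norm].
- apply: branch_error.
  + exact: fingerprint_ge0.
  + exact: fingerprint_norm.
  + by move=> x y; apply: fingerprint_near_orthogonal.
- by rewrite -cardE.
Qed.

End Protocol.

(** * Choice of parameters *)

Lemma test_error_small (C : numClosedFieldType) (k L : nat) :
  (120 * k ^ 4 <= 2 ^ L)%N ->
  (30 * #|test k| ^ 2)%:R * (5%:R / 8%:R : C) ^+ (2 * L) <= 1.
Proof.
move=> kL.
have -> : #|test k| = (2 * (k * k))%N by rewrite !card_prod card_bool !card_ord.
have -> : (30 * (2 * (k * k)) ^ 2 = 120 * k ^ 4)%N by ring.
rewrite exprM expr_div_n.
(* Since (5/8)^2 = 25/64 <= 1/2, using 2L copies brings the error down to 2^-L. *)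
have H : 25%:R / 64%:R <= 2%:R^-1 :> C.
  by rewrite ler_pdivrMr ?ltr0Sn // ler_pdivlMl ?ltr0Sn // -natrM ler_nat.
have H0 : 0 <= 25%:R / 64%:R :> C by rewrite divr_ge0 ?ler0n.
rewrite -!natrX.
apply: (@le_trans _ _ ((2 ^ L)%:R * (2%:R^-1) ^+ L)).
  by rewrite ler_pM ?ler0n ?exprn_ge0 ?ler_nat // lerXn2r ?nnegrE ?invr_ge0 ?ler0n.
by rewrite natrX -exprMn divff ?expr1n // pnatr_eq0.
Qed.

Theorem theorem9 :
  exists (c N : nat), forall k : nat, (N <= k)%N ->
    exists P : qnih_protocol k,
      valid_protocol P /\
      (cost P <= c * k * (trunc_log 2 k) ^ 2)%N /\
      forall adj : rel 'I_k, simple_graph adj ->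
        2 / 3 <= prob_output P (nbhd adj) (neighborhood_diversity adj).
Proof.
(* 480 = 4 * 15 * 2 * 4 comes from 4l + 11 <= 15l and l + 3 <= 4l, valid for l >= 1, that is k >=
   2. *)
exists 480%N, 2%N => k k2.
set l := trunc_log 2 k.
have l_gt0 : (0 < l)%N by rewrite trunc_log_gt0.
have kl : (k < 2 ^ l.+1)%N by rewrite trunc_log_ltn.
(* From 120 <= 2^7 and k < 2^(l+1) follow 120 k^4 <= 2^L and 4k <= 2^r, the size of the field. *)
pose L := (4 * l + 11)%N; pose t := (2 * L)%N; pose r := (l + 3)%N.
have kL : (120 * k ^ 4 <= 2 ^ L)%N.
  apply: (@leq_trans (2 ^ 7 * (2 ^ l.+1) ^ 4)%N).
    by apply: leq_mul => //; rewrite leq_exp2r // ltnW.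
  by rewrite -expnM -expnD leq_exp2l // /L; lia.
have [F _ cardF] := PrimePowerField (isT : prime 2) (ltn_addl l (isT : 0 < 3)%N : (0 < r)%N).
pose M := (2 * t * (2 * r))%N.
have cardW : #|{: {ffun bool * 'I_t -> F * F}}| = (2 ^ M)%N.
  by rewrite card_ffun !card_prod card_bool card_ord cardF mulnn -!expnM /M; congr (2 ^ _)%N; ring.
pose read (i : 'I_(2 ^ M)) : {ffun bool * 'I_t -> F * F} := enum_val (cast_ord (esym cardW) i).
have read_bij : bijective read.
  apply: (bij_comp (h := cast_ord (esym cardW)) (f := enum_val)).
    exact: enum_val_bij.
  by exists (cast_ord cardW); [apply: cast_ordKV|apply: cast_ordK].
have F_large : (4 * k <= #|F|)%N.
  rewrite cardF; apply: (@leq_trans (2 ^ 2 * 2 ^ l.+1)%N).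
    by rewrite leq_mul2l ltnW.
  by rewrite -expnD leq_exp2l // /r; lia.
exists (nd_protocol k read); split; first exact: nd_protocol_valid.
split.
  rewrite nd_protocol_cost /M /t /L /r; move: l_gt0 {kl kL read_bij F_large} => l_gt0.
  suff : (2 * (2 * (4 * l + 11)) * (2 * (l + 3)) <= 480 * l ^ 2)%N.
    by move=> H; rewrite (leq_trans (leq_mul (leqnn k) H)) // mulnCA mulnA.
  by nia.
move=> adj adj_simple; apply: nd_protocol_correct => //.
exact: test_error_small.
Qed.
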